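(* Let $G$ be a finite group. For every $r\in\mathrm{Hom}(G,\widehat{G})$, the linear map $\mathcal{D}(G)\to\mathcal{D}(G)$ given by $e_g\# h\mapsto r(h)e_g\# h$ is an element of $\mathrm{Aut}(\mathcal{D}(G))$. In particular, sending $r$ to this map gives an embedding (injective group homomorphism) $\mathrm{Hom}(G,\widehat{G})\hookrightarrow\mathrm{Aut}(\mathcal{D}(G))$.
   Context: The base field $\mathbbm{k}$ is algebraically closed of characteristic zero. For a finite group $G$, $\mathbbm{k}^G$ is the linear dual of $\mathbbm{k}G$, with dual basis $\{e_g\}_{g\in G}$ and identity $\varepsilon=\sum_{g}e_g$; $\widehat{G}=\mathrm{Hom}(G,\mathbbm{k}^\times)$ is the group of group-like elements of $\mathbbm{k}^G$, and $\mathrm{Hom}(G,\widehat{G})$ is a group under pointwise multiplication. The product $r(h)e_g$ is taken in $\mathbbm{k}^G$. The Drinfeld double $\mathcal{D}(G)$ is the Hopf algebra with basis $e_g\# h$ ($g,h\in G$), multiplication $(e_g\# g')(e_h\# h')=\delta_{g,\,g'hg'^{-1}}\,e_g\# g'h'$, unit $\varepsilon\# 1$, and coalgebra structure $(\mathbbm{k}^G)^{\mathrm{cop}}\otimes\mathbbm{k}G$. $\mathrm{Aut}(\mathcal{D}(G))$ is its group of Hopf algebra automorphisms. *)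

(* Defs.v *)
From HB Require Import structures.
From mathcomp Require Import all_boot all_order all_algebra all_fingroup all_field.

Set Implicit Arguments.
Unset Strict Implicit.
Unset Printing Implicit Defensive.

Import GRing.Theory.
Local Open Scope ring_scope.

(* The tensor product of two finite-dimensional spaces, realised as matrices
   of coordinates in the library's chosen bases [vbasis fullv]. *)
Notation tensor V W := 'M_(\dim (@fullv _ V), \dim (@fullv _ W)).

Fact linear_comb (K : fieldType) (V W : lmodType K) (I : finType)
    (a : I -> K) (x : I -> V) (f : V -> W) :
  linear f -> f (\sum_i a i *: x i) = \sum_i a i *: f (x i).
Proof.
move=> linf; pose g : {linear V -> W} :=
  HB.pack f (GRing.isLinear.Build K V W _ f linf).
rewrite -[f]/(g : V -> W) linear_sum; apply: eq_bigr => i _.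
exact: (linearZ_LR g).
Qed.

Section LinearFun.
Variables (K : fieldType) (V W : lmodType K) (f : V -> W).
Hypothesis linf : linear f.

Fact linear_add : {morph f : x y / x + y}.
Proof. by move=> x y; rewrite -[x]scale1r linf !scale1r. Qed.

Fact linear_zero : f 0 = 0.
Proof. by rewrite -[0 in LHS](subrr 0) -scaleN1r addrC linf scaleN1r addNr. Qed.

Fact linear_sum_fun (I : finType) (F : I -> V) : f (\sum_i F i) = \sum_i f (F i).
Proof. exact: (big_morph f linear_add linear_zero). Qed.

End LinearFun.

Section Tensor.
Variables (K : fieldType) (V W : vectType K).

Definition tens (u : V) (v : W) : 'M[K]_(\dim (@fullv _ V), \dim (@fullv _ W)) :=
  \matrix_(i, j) (coord (vbasis fullv) i u * coord (vbasis fullv) j v).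

(* The linear map on the tensor product induced by a bilinear [B]
   (see [tlift_tens]); [B] is only evaluated on basis vectors. *)
Definition tlift (X : lmodType K) (B : V -> W -> X)
    (M : 'M[K]_(\dim (@fullv _ V), \dim (@fullv _ W))) : X :=
  \sum_i \sum_j M i j *: B (vbasis fullv)`_i (vbasis fullv)`_j.

Fact tlift_is_linear (X : lmodType K) (B : V -> W -> X) : linear (tlift B).
Proof.
move=> a M N; rewrite /tlift scaler_sumr -big_split; apply: eq_bigr => i _ /=.
rewrite scaler_sumr -big_split; apply: eq_bigr => j _ /=.
by rewrite !mxE scalerDl scalerA.
Qed.

HB.instance Definition _ (X : lmodType K) (B : V -> W -> X) :=
  GRing.isLinear.Build K _ X _ (tlift B) (tlift_is_linear B).

Lemma tlift_tens (X : lmodType K) (B : V -> W -> X) u v :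
  (forall y, linear (B^~ y)) -> (forall x, linear (B x)) ->
  tlift B (tens u v) = B u v.
Proof.
move=> linl linr; rewrite {2}(coord_vbasis (memvf u)) (linear_comb _ _ (linl v)).
apply: eq_bigr => i _; rewrite {2}(coord_vbasis (memvf v)).
rewrite (linear_comb _ _ (linr _)) scaler_sumr.
by apply: eq_bigr => j _; rewrite mxE scalerA.
Qed.

Lemma tlift_param_linear (U X : lmodType K) (B : U -> V -> W -> X) M :
  (forall u v, linear (fun z => B z u v)) -> linear (fun z => tlift (B z) M).
Proof.
move=> linB a x y; rewrite /tlift scaler_sumr -big_split; apply: eq_bigr => i _.
rewrite /= scaler_sumr -big_split; apply: eq_bigr => j _ /=.
by rewrite linB scalerDr !scalerA mulrC.
Qed.

Fact tensl_is_linear v : linear (tens^~ v).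
Proof. by move=> a x y; apply/matrixP=> i j; rewrite !mxE linearP /= mulrDl mulrA. Qed.

Fact tensr_is_linear u : linear (tens u).
Proof.
by move=> a x y; apply/matrixP=> i j; rewrite !mxE linearP /= mulrDr mulrCA.
Qed.

HB.instance Definition _ u :=
  GRing.isLinear.Build K W _ _ (tens u) (tensr_is_linear u).

End Tensor.

Definition tmap (K : fieldType) (V W V' W' : vectType K)
    (f : 'Hom(V, V')) (g : 'Hom(W, W')) : 'Hom(tensor V W, tensor V' W') :=
  linfun (tlift (fun u v => tens (f u) (g v))).

Definition tmul (K : fieldType) (A : falgType K) (M N : tensor A A) : tensor A A :=
  tlift (fun a b => tlift (fun c d => tens (a * c) (b * d)) N) M.

(* [tlift (fun y z => E y z) (comul x)] is E x_(1) x_(2) in Sweedler notation. *)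
HB.mixin Record Falgebra_isHopf (K : fieldType) H of Falgebra K H := {
  comul : 'Hom(H, tensor H H);
  counit : 'Hom(H, K^o);
  antipode : 'End(H);
  comulA : forall x : H,
    tlift (fun y z => tlift (fun y1 y2 => tens y1 (tens y2 z)) (comul y))
          (comul x)
    = tlift (fun y z => tens y (comul z)) (comul x);
  counitl : forall x : H, tlift (fun y z => counit y *: z) (comul x) = x;
  counitr : forall x : H, tlift (fun y z => counit z *: y) (comul x) = x;
  comulM : forall x y : H, comul (x * y) = tmul (comul x) (comul y);
  comul1 : comul 1 = tens 1 1;
  counitM : forall x y : H, counit (x * y) = (counit x : K) * counit y;
  counit1 : counit 1 = 1;
  antipodel : forall x : H,
    tlift (fun y z => antipode y * z) (comul x) = (counit x : K)%:A;
  antipoder : forall x : H,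
    tlift (fun y z => y * antipode z) (comul x) = (counit x : K)%:A
}.

#[short(type="hopfType")]
HB.structure Definition Hopf (K : fieldType) :=
  { H of Falgebra K H & Falgebra_isHopf K H }.

Section HopfAut.
Variables (K : fieldType) (H : hopfType K).
Implicit Types f g : 'End(H).

(* [lker f == 0] is bijectivity, [H] being finite-dimensional.
   Compatibility with the antipode is automatic for bialgebra maps; it is
   kept as part of the definition. *)
Definition is_hopf_aut : pred 'End(H) := fun f =>
  [&& lker f == 0%VS, ahom_in fullv f,
      (comul \o f == tmap f f \o comul)%VF,
      (counit \o f == counit :> 'Hom(H, K^o))%VF &
      (f \o antipode == antipode \o f)%VF].

(* The group operation declared below is f * g = f \o g. *)
Record hopf_aut := HopfAut { hopf_aut_fun :> 'End(H); _ : is_hopf_aut hopf_aut_fun }.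

HB.instance Definition _ := [isSub for hopf_aut_fun].
HB.instance Definition _ := [Choice of hopf_aut by <:].

Lemma tmap_comp (U V W : vectType K) (f : 'Hom(V, W)) (g : 'Hom(U, V))  :
  tmap (f \o g)%VF (f \o g)%VF = (tmap f f \o tmap g g)%VF.
Proof.
apply/lfunP => M; rewrite comp_lfunE [tmap g g M]lfunE [LHS]lfunE /=.
rewrite [RHS]linear_sum; apply: eq_bigr => i _.
rewrite [RHS]linear_sum; apply: eq_bigr => j _.
rewrite linearZ /= [in RHS]lfunE /= tlift_tens ?comp_lfunE // => [v|v] a x y.
  by rewrite linearP; apply: tensl_is_linear.
by rewrite linearP; apply: tensr_is_linear.
Qed.

Lemma tensE (V W : vectType K) (M : tensor V W) :
  tlift (@tens K V W) M = M.
Proof.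
apply/matrixP => i j; rewrite /tlift summxE (bigD1 i) //= summxE (bigD1 j) //=.
have fb (U : vectType K) (a b : 'I_(\dim (@fullv _ U))) :
    coord (vbasis fullv) a (vbasis (@fullv _ U))`_b = (b == a)%:R.
  by rewrite coord_free // (basis_free (vbasisP _)).
rewrite !mxE !fb !eqxx !mulr1 big1 ?addr0 => [|l nl]; last first.
  by rewrite !mxE !fb (negPf nl) !mulr0.
rewrite big1 ?addr0 // => l nl; rewrite summxE big1 // => m _.
by rewrite !mxE !fb (negPf nl) mul0r mulr0.
Qed.

Lemma tmap1 (V : vectType K) :
  tmap (\1 : 'End(V))%VF (\1 : 'End(V))%VF = \1%VF.
Proof.
apply/lfunP => M; rewrite lfunE /= id_lfunE -[RHS]tensE.
by apply: eq_bigr => i _; apply: eq_bigr => j _; rewrite !id_lfunE.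
Qed.

Lemma hopf_autP f :
  reflect [/\ lker f = 0%VS, monoid_morphism f,
              (comul \o f)%VF = (tmap f f \o comul)%VF,
              (counit \o f)%VF = counit :> 'Hom(H, K^o) &
              (f \o antipode)%VF = (antipode \o f)%VF]
          (is_hopf_aut f).
Proof.
apply: (iffP and5P) => [[/eqP? /ahomP_tmp? /eqP? /eqP? /eqP?]|[-> ? -> -> ->]].
  by split.
by split; rewrite ?eqxx //; apply/ahomP_tmp.
Qed.

Fact hopf_aut1_subproof : is_hopf_aut \1%VF.
Proof.
apply/hopf_autP; rewrite tmap1 !comp_lfun1l !comp_lfun1r; split=> //.
- by apply/eqP/lker0P => x y; rewrite !id_lfunE.
- by apply/ahomP_tmp; apply: id_is_ahom.
Qed.

Fact hopf_autM_subproof f g :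
  is_hopf_aut f -> is_hopf_aut g -> is_hopf_aut (f \o g)%VF.
Proof.
move=> /hopf_autP[/eqP kf /ahomP_tmp mf df cf sf].
move=> /hopf_autP[/eqP kg /ahomP_tmp mg dg cg sg].
apply/hopf_autP; split.
- by apply/eqP/lker0P => x y; rewrite !comp_lfunE => /(lker0P kf)/(lker0P kg).
- by apply/ahomP_tmp; apply: comp_is_ahom.
- by rewrite tmap_comp comp_lfunA df -!comp_lfunA dg.
- by rewrite comp_lfunA cf cg.
- by rewrite -comp_lfunA sg !comp_lfunA sf.
Qed.

Fact hopf_autV_subproof f : is_hopf_aut f -> is_hopf_aut f^-1%VF.
Proof.
move=> /hopf_autP[/eqP kf [f1 fM] df cf sf].
have fK := lker0_compfV kf; have Kf := lker0_compVf kf.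
have fVK x : f (f^-1%VF x) = x by rewrite -comp_lfunE fK id_lfunE.
have fI := lker0P kf.
apply/hopf_autP; split.
- by apply/eqP/lker0P => x y /(congr1 f); rewrite !fVK.
- by split=> [|x y]; apply: fI; rewrite ?fM !fVK ?f1.
- have e : (tmap f^-1 f^-1 \o (comul \o f) = comul)%VF.
    by rewrite df comp_lfunA -tmap_comp Kf tmap1 comp_lfun1l.
  by rewrite -{1}e -!comp_lfunA fK comp_lfun1r.
- by rewrite -{1}cf -!comp_lfunA fK comp_lfun1r.
- have e : (f^-1 \o (antipode \o f) = antipode)%VF.
    by rewrite -sf comp_lfunA Kf comp_lfun1l.
  by rewrite -{2}e -!comp_lfunA fK comp_lfun1r.
Qed.

Definition hopf_aut_one := HopfAut hopf_aut1_subproof.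
Definition hopf_aut_mul (f g : hopf_aut) :=
  HopfAut (hopf_autM_subproof (valP f) (valP g)).
Definition hopf_aut_inv (f : hopf_aut) := HopfAut (hopf_autV_subproof (valP f)).

Fact hopf_aut_mulA : associative hopf_aut_mul.
Proof. by move=> f g h; apply/val_inj; apply: comp_lfunA. Qed.
Fact hopf_aut_mul1 : left_id hopf_aut_one hopf_aut_mul.
Proof. by move=> f; apply/val_inj; apply: comp_lfun1l. Qed.
Fact hopf_aut_1mul : right_id hopf_aut_one hopf_aut_mul.
Proof. by move=> f; apply/val_inj; apply: comp_lfun1r. Qed.
Fact hopf_aut_mulV : left_inverse hopf_aut_one hopf_aut_inv hopf_aut_mul.
Proof.
by move=> f; apply/val_inj/lker0_compVf; case/and5P: (valP f).
Qed.
Fact hopf_aut_Vmul : right_inverse hopf_aut_one hopf_aut_inv hopf_aut_mul.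
Proof.
by move=> f; apply/val_inj/lker0_compfV; case/and5P: (valP f).
Qed.

HB.instance Definition _ := isGroup.Build hopf_aut
  hopf_aut_mulA hopf_aut_mul1 hopf_aut_1mul hopf_aut_mulV hopf_aut_Vmul.

End HopfAut.

HB.mixin Record Group_isAbelian G of monoid.Group G := {
  abgC : commutative (@monoid.mul G)
}.

#[short(type="abGroupType")]
HB.structure Definition AbGroup := { G of monoid.Group G & Group_isAbelian G }.

Section HomGroup.
Variables (gT : finGroupType) (A : abGroupType).
Local Open Scope group_scope.

Definition is_ghom (f : {ffun gT -> A}) :=
  [forall x, forall y, f (x * y) == f x * f y].

(* Hom(gT, A), a group under pointwise multiplication. *)
Record ghom := Ghom { ghom_fun :> {ffun gT -> A}; _ : is_ghom ghom_fun }.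

HB.instance Definition _ := [isSub for ghom_fun].
HB.instance Definition _ := [Choice of ghom by <:].

Lemma ghomM (f : ghom) x y : f (x * y) = f x * f y.
Proof. by case: f => f /= /forallP/(_ x)/forallP/(_ y)/eqP. Qed.

Fact ghom_closed : group_closed is_ghom.
Proof.
split=> [|f g fP gP].
  by apply/forallP => x; apply/forallP => y; rewrite !ffunE mulg1.
apply/forallP => x; apply/forallP => y; rewrite !ffunE.
rewrite (ghomM (Ghom fP)) (ghomM (Ghom gP)) /= invgM -!mulgA; apply/eqP.
by congr (_ * _); rewrite !mulgA abgC -!mulgA; congr (_ * _); rewrite abgC.
Qed.

HB.instance Definition _ := monoid.SubChoice_isSubGroup.Build _ is_ghom ghom ghom_closed.

Fact ghom_mulC : commutative (@monoid.mul ghom).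
Proof. by move=> f g; apply/val_inj/ffunP => x; rewrite !ffunE abgC. Qed.

HB.instance Definition _ := Group_isAbelian.Build ghom ghom_mulC.

End HomGroup.

Section MultiplicativeGroup.
Variable K : fieldType.

Record unitgroup := UnitGroup { unitgroup_val :> K; _ : unitgroup_val != 0 }.

HB.instance Definition _ := [isSub for unitgroup_val].
HB.instance Definition _ := [Choice of unitgroup by <:].
Implicit Types x y : unitgroup.

Definition unitgroup_one := UnitGroup (oner_neq0 K).
Fact unitgroup_mul_subproof x y : (x : K) * (y : K) != 0.
Proof. by rewrite mulf_neq0 //; [case: x|case: y]. Qed.
Definition unitgroup_mul x y := UnitGroup (unitgroup_mul_subproof x y).
Fact unitgroup_inv_subproof x : (x : K)^-1 != 0.
Proof. by rewrite invr_eq0; case: x. Qed.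
Definition unitgroup_inv x := UnitGroup (unitgroup_inv_subproof x).

Fact unitgroup_mulA : associative unitgroup_mul.
Proof. by move=> x y z; apply/val_inj/mulrA. Qed.
Fact unitgroup_mul1 : left_id unitgroup_one unitgroup_mul.
Proof. by move=> x; apply/val_inj/mul1r. Qed.
Fact unitgroup_1mul : right_id unitgroup_one unitgroup_mul.
Proof. by move=> x; apply/val_inj/mulr1. Qed.
Fact unitgroup_mulV : left_inverse unitgroup_one unitgroup_inv unitgroup_mul.
Proof. by move=> x; apply/val_inj/mulVf; case: x. Qed.
Fact unitgroup_Vmul : right_inverse unitgroup_one unitgroup_inv unitgroup_mul.
Proof. by move=> x; apply/val_inj/mulfV; case: x. Qed.

HB.instance Definition _ := isGroup.Build unitgroup
  unitgroup_mulA unitgroup_mul1 unitgroup_1mul unitgroup_mulV unitgroup_Vmul.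

Fact unitgroup_mulC : commutative (@monoid.mul unitgroup).
Proof. by move=> x y; apply/val_inj/mulrC. Qed.

HB.instance Definition _ := Group_isAbelian.Build unitgroup unitgroup_mulC.

End MultiplicativeGroup.

Definition dualgroup (K : fieldType) (gT : finGroupType) : abGroupType :=
  ghom gT (unitgroup K).

Section FunctionAlgebra.
Variables (K : fieldType) (gT : finGroupType).

(* [{ffun gT -> K}], with the library's pointwise ring structure, is the dual
   algebra of the group algebra; its 1 is the counit of the group algebra. *)
Definition dbase (g : gT) : {ffun gT -> K} := [ffun x => (x == g)%:R].

Definition char_fun (chi : dualgroup K gT) : {ffun gT -> K} :=
  [ffun g => unitgroup_val (ghom_fun chi g)].

End FunctionAlgebra.

(* [x : drinfeld_double K gT] is sum_(g, h) x (g, h) e_g # h. *)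
Definition drinfeld_double (K : fieldType) (gT : finGroupType) := {ffun gT * gT -> K^o}.

Section Double.
Variables (K : fieldType) (gT : finGroupType).
Local Notation D := (drinfeld_double K gT).

HB.instance Definition _ := Vector.on D.

(* The element f # h; the basis vector e_g # h is [smash (dbase K g) h]. *)
Definition smash (f : {ffun gT -> K}) (h : gT) : D :=
  [ffun p => f p.1 *+ (p.2 == h)].

Definition dbasis (p : gT * gT) : D := smash (dbase K p.1) p.2.

(* Linear extension of a map defined on the basis. *)
Definition dlift (X : lmodType K) (B : gT * gT -> X) (x : D) : X :=
  \sum_p (x p : K) *: B p.

Definition double_mul_basis (p q : gT * gT) : D :=
  if p.1 == (p.2 * q.1 * p.2^-1)%g then dbasis (p.1, (p.2 * q.2)%g) else 0.

Definition double_mul (x y : D) : D :=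
  dlift (fun p => dlift (fun q => double_mul_basis p q) y) x.

Definition double_one : D := smash 1 1%g.

Fact dlift_is_linear (X : lmodType K) (B : gT * gT -> X) : linear (dlift B).
Proof.
move=> a x y; rewrite /dlift scaler_sumr -big_split; apply: eq_bigr => p _ /=.
by rewrite !ffunE scalerDl scalerA.
Qed.

HB.instance Definition _ (X : lmodType K) (B : gT * gT -> X) :=
  GRing.isLinear.Build K D X _ (dlift B) (dlift_is_linear B).

Lemma dbasisE p q : dbasis p q = (q == p)%:R.
Proof.
by rewrite !ffunE; case: p q => [g h] [a b]; rewrite xpair_eqE /= -mulrnA mulnb.
Qed.

Lemma dlift_basis (X : lmodType K) (B : gT * gT -> X) p : dlift B (dbasis p) = B p.
Proof.
rewrite /dlift (bigD1 p) //= dbasisE eqxx scale1r big1 ?addr0 // => q /negPf nq.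
by rewrite dbasisE nq scale0r.
Qed.

Lemma dlift_id x : dlift dbasis x = x.
Proof.
apply/ffunP => q; rewrite sum_ffunE (bigD1 q) //= ffunE dbasisE eqxx.
rewrite big1 ?addr0 => [|p np]; first exact: mulr1.
by rewrite ffunE dbasisE eq_sym (negPf np); apply: mulr0.
Qed.

Lemma double_ind (P : D -> Prop) :
  P 0 -> (forall a x y, P x -> P y -> P (a *: x + y)) ->
  (forall p, P (dbasis p)) -> forall x, P x.
Proof.
move=> P0 PD Pb x; rewrite -(dlift_id x) /dlift.
by elim/big_rec: _ => // p y _; apply: PD.
Qed.

Fact double_mull_is_linear y : linear (double_mul^~ y).
Proof. by move=> a x z; apply: linearP. Qed.

Fact double_mulr_is_linear x : linear (double_mul x).
Proof.
move=> a y z; rewrite /double_mul /dlift scaler_sumr -big_split.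
apply: eq_bigr => p _ /=; rewrite -/(dlift _ _) -/(dlift _ y) -/(dlift _ z).
by rewrite linearP scalerDr !scalerA mulrC.
Qed.

Lemma double_mul_basisE p q :
  double_mul (dbasis p) (dbasis q) = double_mul_basis p q.
Proof. by rewrite /double_mul !dlift_basis. Qed.

Lemma double_oneE : double_one = \sum_g dbasis (g, 1%g).
Proof.
apply/ffunP => [[g h]]; rewrite sum_ffunE (bigD1 g) //= big1 => [|l nl].
  by rewrite addr0 !ffunE eqxx.
by rewrite !ffunE /= eq_sym (negPf nl) mul0rn.
Qed.

Fact double_mulDl : left_distributive double_mul +%R.
Proof. by move=> x y z; rewrite -[x]scale1r double_mull_is_linear !scale1r. Qed.
Fact double_mulDr : right_distributive double_mul +%R.
Proof. by move=> x y z; rewrite -[y]scale1r double_mulr_is_linear !scale1r. Qed.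
Fact double_mul0 x : double_mul x 0 = 0.
Proof. by rewrite -[0 in LHS](subrr 0) -scaleN1r addrC double_mulr_is_linear scaleN1r addNr. Qed.
Fact double_0mul x : double_mul 0 x = 0.
Proof. by rewrite /double_mul linear0. Qed.

Fact double_mulA : associative double_mul.
Proof.
elim/double_ind => [|a x x' IHx IHx'|p] y z; first by rewrite !double_0mul.
  by rewrite !double_mull_is_linear IHx IHx'.
elim/double_ind: y => [|a y y' IHy IHy'|q].
- by rewrite !double_mul0 !double_0mul ?double_mul0.
- by rewrite !(double_mulr_is_linear, double_mull_is_linear) IHy IHy'.
elim/double_ind: z => [|a z z' IHz IHz'|r]; first by rewrite !double_mul0.
  by rewrite !double_mulr_is_linear IHz IHz'.
case: p q r => [g a] [h b] [l c]; rewrite !double_mul_basisE /double_mul_basis /=.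
have [-> | nh] := altP (h =P _); last first.
  rewrite double_mul0; have [-> | ng] := altP (g =P _); last by rewrite double_0mul.
  rewrite double_mul_basisE /double_mul_basis /= invMg !mulgA.
  by rewrite -!mulgA !(inj_eq (mulgI _)) !mulgA (inj_eq (mulIg _)) (negPf nh).
rewrite double_mul_basisE /double_mul_basis /= !mulgA.
case: (altP (g =P _)) => [-> | ng]; last by rewrite double_0mul.
by rewrite double_mul_basisE /double_mul_basis /= invMg !mulgA eqxx.
Qed.

Fact double_mul1 : left_id double_one double_mul.
Proof.
elim/double_ind => [|a x x' IHx IHx'|[g a]]; first exact: double_mul0.
  by rewrite double_mulr_is_linear IHx IHx'.
rewrite double_oneE (big_morph (double_mul^~ _) (fun x y => double_mulDl x y _) (double_0mul _)).
rewrite (bigD1 g) //= double_mul_basisE /double_mul_basis /= invg1 mulg1 !mul1g eqxx.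
rewrite big1 ?addr0 // => h nh.
by rewrite double_mul_basisE /double_mul_basis /= invg1 mulg1 mul1g (negPf nh).
Qed.

Fact double_1mul : right_id double_one double_mul.
Proof.
elim/double_ind => [|a x x' IHx IHx'|[g a]]; first exact: double_0mul.
  by rewrite double_mull_is_linear IHx IHx'.
rewrite double_oneE (big_morph (double_mul _) (double_mulDr _) (double_mul0 _)).
rewrite (bigD1 (g ^ a)%g) //= double_mul_basisE /double_mul_basis /=.
rewrite /conjg mulg1 !mulgA mulgV mul1g mulgK eqxx big1 ?addr0 // => h nh.
rewrite double_mul_basisE /double_mul_basis /= mulg1.
case: eqP => // gE; case/eqP: nh.
by rewrite gE /conjg !mulgA mulVg mul1g mulgKV.
Qed.

Fact double_1neq0 : double_one != 0.
Proof.
apply/eqP => /ffunP/(_ (1%g, 1%g)); rewrite !ffunE /= eqxx => /eqP.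
by rewrite (oner_eq0 K).
Qed.

HB.instance Definition _ := GRing.Zmodule_isNzRing.Build D
  double_mulA double_mul1 double_1mul double_mulDl double_mulDr double_1neq0.

Fact double_scaleAl (a : K) (x y : D) : a *: (x * y) = a *: x * y.
Proof.
by rewrite -[a *: x]addr0 [RHS]double_mull_is_linear [double_mul 0 _]double_0mul addr0.
Qed.

HB.instance Definition _ := GRing.Lmodule_isLalgebra.Build K D double_scaleAl.

Fact double_scaleAr (a : K) (x y : D) : a *: (x * y) = x * (a *: y).
Proof.
by rewrite -[a *: y]addr0 [RHS]double_mulr_is_linear [double_mul _ 0]double_mul0 addr0.
Qed.

HB.instance Definition _ := GRing.Lalgebra_isAlgebra.Build K D double_scaleAr.
HB.instance Definition _ := Algebra_isFalgebra.Build K D.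

(* The comultiplication of the function algebra is
   e_g |-> sum_u e_u (x) e_(u^-1 g); the two factors are swapped here. *)
Definition double_comul : 'Hom(D, tensor D D) :=
  linfun (dlift (fun p =>
    \sum_u tens (dbasis ((u^-1 * p.1)%g, p.2)) (dbasis (u, p.2)))).

Definition double_counit : 'Hom(D, K^o) :=
  linfun (dlift (fun p => (p.1 == 1%g)%:R : K^o)).

Definition double_antipode : 'End(D) :=
  linfun (dlift (fun p => dbasis ((p.2^-1 * p.1^-1 * p.2)%g, p.2^-1%g))).

Lemma double_mulbE p q : dbasis p * dbasis q = double_mul_basis p q.
Proof. exact: double_mul_basisE. Qed.

Lemma double_comulE p : double_comul (dbasis p) =
  \sum_u tens (dbasis ((u^-1 * p.1)%g, p.2)) (dbasis (u, p.2)).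
Proof. by rewrite lfunE /= dlift_basis. Qed.

Lemma double_counitE p : double_counit (dbasis p) = (p.1 == 1%g)%:R.
Proof. by rewrite lfunE /= dlift_basis. Qed.

Lemma double_antipodeE p :
  double_antipode (dbasis p) = dbasis ((p.2^-1 * p.1^-1 * p.2)%g, p.2^-1%g).
Proof. by rewrite lfunE /= dlift_basis. Qed.

Lemma double_lin_ext (X : lmodType K) (f g : D -> X) : linear f -> linear g ->
  (forall p, f (dbasis p) = g (dbasis p)) -> f =1 g.
Proof.
move=> lf lg fg x; rewrite -(dlift_id x) /dlift !linear_comb //.
by apply: eq_bigr => p _; rewrite fg.
Qed.

Lemma tlift_comul (X : lmodType K) (B : D -> D -> X) p :
  (forall y, linear (B^~ y)) -> (forall x, linear (B x)) ->
  tlift B (double_comul (dbasis p)) =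
  \sum_u B (dbasis ((u^-1 * p.1)%g, p.2)) (dbasis (u, p.2)).
Proof.
move=> Bl Br; rewrite double_comulE linear_sum.
by apply: eq_bigr => u _; apply: tlift_tens.
Qed.

Fact tlift_comul_linear (X : lmodType K) (B : D -> D -> X) :
  linear (fun x => tlift B (double_comul x)).
Proof. by move=> a x y; rewrite !linearP. Qed.

Fact double_comulA (x : D) :
  tlift (fun y z =>
    tlift (fun y1 y2 => tens y1 (tens y2 z)) (double_comul y)) (double_comul x)
  = tlift (fun y z => tens y (double_comul z)) (double_comul x).
Proof.
move: x; apply: double_lin_ext; try exact: tlift_comul_linear.
move=> [g a]; rewrite !tlift_comul /=; first 1 last.
- by move=> y b u v; rewrite tensl_is_linear.
- by move=> y b u v; rewrite !linearP.
- by move=> y; apply: tlift_comul_linear.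
- move=> y; apply: tlift_param_linear => u v b z z'.
  by rewrite tensr_is_linear linearP.
under eq_bigr => u _.
  rewrite tlift_comul /=; first over.
  - by move=> y b v w; rewrite tensl_is_linear.
  - by move=> y b v w; rewrite tensl_is_linear linearP.
under [RHS]eq_bigr => u _ do rewrite double_comulE linear_sum /=.
rewrite [RHS]exchange_big /=; apply: eq_bigr => u _.
rewrite [RHS](reindex_inj (mulgI u)) /=; apply: eq_bigr => v _.
by rewrite mulKg invMg !mulgA.
Qed.

Fact double_counitl (x : D) :
  tlift (fun y z => double_counit y *: z) (double_comul x) = x.
Proof.
move: x; apply: double_lin_ext => //; first exact: tlift_comul_linear.
move=> [g a]; rewrite tlift_comul /= => [|y b u v|y b u v].
- rewrite (bigD1 g) //= double_counitE /= mulVg eqxx scale1r big1 ?addr0 //.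
  move=> h nh; rewrite double_counitE /= -eq_mulVg1 (negPf nh).
  exact: scale0r.
- by rewrite linearP scalerDl scalerA.
- by rewrite scalerDr !scalerA mulrC.
Qed.

Fact double_counitr (x : D) :
  tlift (fun y z => double_counit z *: y) (double_comul x) = x.
Proof.
move: x; apply: double_lin_ext => //; first exact: tlift_comul_linear.
move=> [g a]; rewrite tlift_comul /= => [|y b u v|y b u v].
- rewrite (bigD1 1%g) //= double_counitE /= eqxx scale1r invg1 mul1g.
  rewrite big1 ?addr0 // => h nh.
  rewrite double_counitE /= (negPf nh); exact: scale0r.
- by rewrite scalerDr !scalerA mulrC.
- by rewrite linearP scalerDl scalerA.
Qed.

Lemma tmul_linearl (N : tensor D D) : linear ((@tmul K D)^~ N).
Proof. by move=> a M M'; rewrite /tmul linearP. Qed.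

Lemma tmul_linearr (M : tensor D D) : linear (@tmul K D M).
Proof. by apply: tlift_param_linear => u v a N N'; rewrite linearP. Qed.

Lemma tmul_tens (a b c d : D) : tmul (tens a b) (tens c d) = tens (a * c) (b * d).
Proof.
rewrite /tmul tlift_tens.
- by rewrite tlift_tens // => y e u v;
     rewrite mulrDr -scalerAr ?tensl_is_linear ?linearP.
- move=> y; apply: tlift_param_linear => u v e z z'.
  by rewrite mulrDl -scalerAl tensl_is_linear.
- move=> x; apply: tlift_param_linear => u v e z z'.
  by rewrite mulrDl -scalerAl linearP.
Qed.

Fact double_comulM (x y : D) :
  double_comul (x * y) = tmul (double_comul x) (double_comul y).
Proof.
elim/double_ind: x => [|b x x' IHx IHx'|[g a]].
- by rewrite mul0r linear0 /tmul linear0.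
- by rewrite mulrDl -scalerAl !linearP /= tmul_linearl IHx IHx'.
move: y; apply: double_lin_ext.
- by move=> b u v; rewrite mulrDr -scalerAr linearP.
- by move=> b u v; rewrite linearP /= tmul_linearr.
move=> [h b]; rewrite double_mulbE /double_mul_basis /=.
rewrite [double_comul (dbasis (g, a))]double_comulE /=.
rewrite (big_morph ((@tmul K D)^~ _) (fun M M' => linear_add (tmul_linearl _) M M')
          (linear_zero (tmul_linearl _))).
have -> : double_comul (if g == (a * h * a^-1)%g then dbasis (g, (a * b)%g) else 0)
    = \sum_u if g == (a * h * a^-1)%g then
        tens (dbasis ((u^-1 * g)%g, (a * b)%g)) (dbasis (u, (a * b)%g)) else 0.
  by case: ifP => _; rewrite ?double_comulE // linear0 big1.
apply: eq_bigr => u _; rewrite double_comulE /=.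
rewrite (big_morph (@tmul K D _) (linear_add (tmul_linearr _))
          (linear_zero (tmul_linearr _))).
rewrite (bigD1 (a^-1 * u * a)%g) //= big1 => [|v nv]; last first.
  rewrite tmul_tens [X in tens _ X]double_mulbE /double_mul_basis /=.
  case: eqP => [uE|_]; last exact: linear0.
  by case/eqP: nv; rewrite uE !mulgA mulVg mul1g mulgKV.
rewrite addr0 tmul_tens !double_mulbE /double_mul_basis /=.
rewrite !mulgA mulgV mul1g mulgK eqxx !invMg invgK !mulgA mulgV mul1g.
rewrite -!mulgA (inj_eq (mulgI _)) !mulgA.
by case: ifP => // _; rewrite (linear_zero (tensl_is_linear _)).
Qed.

Fact double_comul1 : double_comul 1 = tens 1 1.
Proof.
rewrite [1]double_oneE linear_sum /= (linear_sum_fun (tensr_is_linear _)).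
under eq_bigr => g _ do rewrite double_comulE /=.
rewrite exchange_big /=; apply: eq_bigr => u _.
rewrite (linear_sum_fun (tensl_is_linear _)) (reindex_inj (mulgI u)) /=.
by apply: eq_bigr => v _; rewrite mulKg.
Qed.

Fact double_counitM (x y : D) :
  double_counit (x * y) = (double_counit x : K) * double_counit y.
Proof.
elim/double_ind: x => [|b x x' IHx IHx'|[g a]].
- by rewrite mul0r linear0 mul0r.
- rewrite mulrDl -scalerAl !linearP /= IHx IHx' mulrDl.
  by congr (_ + _); apply: mulrA.
move: y; apply: (double_lin_ext (X := K^o)).
- by move=> b u v; rewrite mulrDr -scalerAr linearP.
- move=> b u v; rewrite linearP /= mulrDr.
  by congr (_ + _); apply: mulrCA.
move=> [h b]; rewrite double_mulbE /double_mul_basis !double_counitE /=.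
rewrite (fun_if double_counit) double_counitE linear0 /=.
have [->|ng] := eqVneq g 1%g.
  rewrite mul1r -(inj_eq (mulIg a)) mulgKV mul1g -{1}[a]mulg1 (inj_eq (mulgI a)) eq_sym.
  by case: eqP.
by rewrite mul0r if_same.
Qed.

Fact double_counit1 : double_counit 1 = 1.
Proof.
rewrite [1]double_oneE linear_sum (bigD1 1%g) //= double_counitE eqxx.
by rewrite big1 ?addr0 // => g ng; rewrite double_counitE (negPf ng).
Qed.

Fact double_unit_linear : linear (fun x => (double_counit x : K)%:A : D).
Proof. by move=> a u v; rewrite linearP /= scalerDl scalerA. Qed.

Fact double_antipodel (x : D) :
  tlift (fun y z => double_antipode y * z) (double_comul x)
  = (double_counit x : K)%:A.
Proof.
move: x; apply: double_lin_ext.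
- exact: tlift_comul_linear.
- exact: double_unit_linear.
move=> [g a]; rewrite tlift_comul /= => [|y b u v|y b u v].
- rewrite double_counitE /=; have [->|ng] := eqVneq g 1%g.
    rewrite scale1r [1 in RHS]double_oneE [RHS](reindex_inj (conjg_inj a)) /=.
    apply: eq_bigr => u _.
    rewrite double_antipodeE double_mulbE /double_mul_basis /=.
    by rewrite mulg1 !invgK mulVg eqxx /conjg mulgA.
  rewrite scale0r big1 // => u _.
  rewrite double_antipodeE double_mulbE /double_mul_basis /=.
  rewrite invMg !invgK (inj_eq (mulIg _)) (inj_eq (mulgI _)).
  by rewrite -{2}[u]mul1g (inj_eq (mulIg _)) invg_eq1 (negPf ng).
- by rewrite linearP mulrDl scalerAl.
- by rewrite mulrDr scalerAr.
Qed.

Fact double_antipoder (x : D) :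
  tlift (fun y z => y * double_antipode z) (double_comul x)
  = (double_counit x : K)%:A.
Proof.
move: x; apply: double_lin_ext.
- exact: tlift_comul_linear.
- exact: double_unit_linear.
move=> [g a]; rewrite tlift_comul /= => [|y b u v|y b u v].
- have E u : (a * (a^-1 * u^-1 * a) * a^-1 = u^-1)%g.
    by rewrite !mulgA mulgV mul1g mulgK.
  rewrite double_counitE /=; have [->|ng] := eqVneq g 1%g.
    rewrite scale1r [1 in RHS]double_oneE [RHS](reindex_inj invg_inj) /=.
    apply: eq_bigr => u _.
    rewrite double_antipodeE double_mulbE /double_mul_basis /=.
    by rewrite E mulg1 mulgV eqxx.
  rewrite scale0r big1 // => u _.
  rewrite double_antipodeE double_mulbE /double_mul_basis /= E.
  by rewrite -{2}[u^-1%g]mulg1 (inj_eq (mulgI _)) (negPf ng).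
- by rewrite mulrDl scalerAl.
- by rewrite linearP mulrDr scalerAr.
Qed.

HB.instance Definition _ := Falgebra_isHopf.Build K D
  double_comulA double_counitl double_counitr double_comulM double_comul1
  double_counitM double_counit1 double_antipodel double_antipoder.

Definition twist (r : ghom gT (dualgroup K gT)) : 'End(D) :=
  linfun (dlift (fun p => smash (char_fun (r p.2) * dbase K p.1) p.2)).

Lemma twistE (r : ghom gT (dualgroup K gT)) g h :
  twist r (smash (dbase K g) h) = smash (char_fun (r h) * dbase K g) h.
Proof. by rewrite lfunE /=; apply: (dlift_basis _ (g, h)). Qed.

End Double.

(* Main.v *)
(* In the basis e_g # h the map attached to r is diagonal, with eigenvalue
   r(h)(g).  It respects the product since r(b) is a class function, hence
   r(a)(g) r(b)(h) = r(ab)(g) as soon as g = a h a^-1; it respects the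
   coproduct since r(h) is multiplicative, and the antipode since inverting
   both arguments of (h, g) |-> r(h)(g) changes nothing. *)

From HB Require Import structures.
Require Import Defs.
From mathcomp Require Import all_boot all_order all_algebra all_fingroup all_field.

Set Implicit Arguments.
Unset Strict Implicit.
Unset Printing Implicit Defensive.

Import GRing.Theory.

Local Open Scope ring_scope.

Section Pairing.
Variables (K : fieldType) (gT : finGroupType).
Implicit Types (r s : ghom gT (dualgroup K gT)) (a b g h : gT).

(** The bicharacter on G with values in the units of K that corresponds to r. *)
Definition pairing r h g : K := unitgroup_val (ghom_fun (ghom_fun r h) g).

Lemma pairing_neq0 r h g : pairing r h g != 0.
Proof. by rewrite /pairing; case: (ghom_fun (ghom_fun r h) g). Qed.

Lemma pairingMl r a b g : pairing r (a * b)%g g = pairing r a g * pairing r b g.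
Proof. by rewrite /pairing ghomM /= ffunE. Qed.

Lemma pairingMr r h a b : pairing r h (a * b)%g = pairing r h a * pairing r h b.
Proof. by rewrite /pairing ghomM. Qed.

Lemma pairing1l r g : pairing r 1%g g = 1.
Proof.
by apply: (mulfI (pairing_neq0 r 1%g g)); rewrite -pairingMl mulg1 mulr1.
Qed.

Lemma pairing1r r h : pairing r h 1%g = 1.
Proof.
by apply: (mulfI (pairing_neq0 r h 1%g)); rewrite -pairingMr mulg1 mulr1.
Qed.

Lemma pairingVl r h g : pairing r h^-1%g g = (pairing r h g)^-1.
Proof.
apply: (mulfI (pairing_neq0 r h g)).
by rewrite -pairingMl mulgV pairing1l mulfV ?pairing_neq0.
Qed.

Lemma pairingVr r h g : pairing r h g^-1%g = (pairing r h g)^-1.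
Proof.
apply: (mulfI (pairing_neq0 r h g)).
by rewrite -pairingMr mulgV pairing1r mulfV ?pairing_neq0.
Qed.

(** Characters take values in a commutative group, so conjugation cancels. *)
Lemma pairingJ r h g a : pairing r h (a * g * a^-1)%g = pairing r h g.
Proof. by rewrite !pairingMr pairingVr mulrAC mulfV ?pairing_neq0 // mul1r. Qed.

Lemma pairing_ghomM r s h g : pairing (r * s)%g h g = pairing r h g * pairing s h g.
Proof. by rewrite /pairing ffunE [in LHS]ffunE. Qed.

Lemma pairing_inj r s : (forall h g, pairing r h g = pairing s h g) -> r = s.
Proof.
move=> rs; apply/val_inj/ffunP => h; apply/val_inj/ffunP => g.
by apply/val_inj; apply: rs.
Qed.

End Pairing.

Section Twist.
Variables (K : fieldType) (gT : finGroupType).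
Local Notation D := (drinfeld_double K gT).
Implicit Types (r s : ghom gT (dualgroup K gT)).

(** Multiplication in the function algebra is pointwise, so r(h) e_g is the value r(h)(g) times e_g.
    All later checks reduce to these eigenvalues. *)
Lemma twist_basis r p :
  twist r (dbasis K p) = pairing r p.2 p.1 *: dbasis K p.
Proof.
rewrite [LHS]twistE; apply/ffunP => q; rewrite !ffunE.
case: (q.1 =P p.1) => [->|_]; first exact: esym (mulrnAr _ _ _).
by rewrite mulr0 mul0rn scaler0.
Qed.

Lemma tensZl (V W : vectType K) (a : K) (v : V) (w : W) :
  tens (a *: v) w = a *: tens v w.
Proof. by apply/matrixP => i j; rewrite !mxE linearZ /= mulrA. Qed.

Lemma tmap_tens (f g : 'End(D)) (x y : D) :
  tmap f g (tens x y) = tens (f x) (g y).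
Proof.
rewrite lfunE /= tlift_tens // => z a u v.
  by rewrite linearP tensl_is_linear.
by rewrite !linearP.
Qed.

Lemma twist_ker r : lker (twist r) = 0%VS.
Proof.
apply/eqP; rewrite -subv0; apply/subvP => x; rewrite memv_ker memv0 => /eqP tx.
rewrite -[x]dlift_id in tx *; move: tx; rewrite /dlift linear_sum /= => tx.
(* Coordinate p of the image is [x p] times a nonzero eigenvalue, so [x p] vanishes. *)
apply/eqP/big1 => p _; move/ffunP/(_ p): tx; rewrite sum_ffunE (bigD1 p) //=.
rewrite big1 => [|q nq]; rewrite linearZ /= twist_basis scalerA ffunE dbasisE.
  rewrite eqxx addr0 ffunE => /eqP; rewrite scaler_eq0 oner_eq0 orbF.
  by rewrite mulf_eq0 (negPf (pairing_neq0 _ _ _)) orbF => /eqP ->; rewrite scale0r.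
by rewrite eq_sym (negPf nq) scaler0.
Qed.

Lemma twist1 r : twist r 1 = 1.
Proof.
rewrite [1]double_oneE linear_sum /=; apply: eq_bigr => g _ /=.
by rewrite twist_basis pairing1l scale1r.
Qed.

Lemma twistM r (x y : D) : twist r (x * y) = twist r x * twist r y.
Proof.
elim/double_ind: x => [|b x x' IHx IHx'|[g a]].
- by rewrite mul0r linear0 mul0r.
- by rewrite mulrDl -scalerAl !linearP /= IHx IHx' mulrDl -scalerAl.
elim/double_ind: y => [|b y y' IHy IHy'|[h b]].
- by rewrite mulr0 linear0 mulr0.
- by rewrite mulrDr -scalerAr !linearP /= IHy IHy' mulrDr -scalerAr.
rewrite !twist_basis -scalerAl -scalerAr scalerA double_mulbE.
rewrite /double_mul_basis /=; case: eqP => [->|_]; last by rewrite linear0 scaler0.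
(* In the surviving case g = a h a^-1, and [pairingJ] replaces this conjugate by h in every
   eigenvalue. *)
by rewrite twist_basis /= pairingMl !pairingJ.
Qed.

Lemma twist_comul r :
  (comul \o twist r = tmap (twist r) (twist r) \o (comul : 'Hom(D, _)))%VF.
Proof.
apply/lfunP; apply: double_lin_ext; try by move=> a x y; rewrite linearP.
move=> p; rewrite !comp_lfunE twist_basis linearZ /= !double_comulE.
rewrite scaler_sumr [RHS]linear_sum /=; apply: eq_bigr => u _.
rewrite tmap_tens !twist_basis linearZ /= tensZl.
(* The two tensor factors contribute r(h)(u) and r(h)(u^-1 g); their product r(h)(g) is independent
   of u. *)
by rewrite scalerA -pairingMr mulKVg.
Qed.

(** The counit kills e_g # h unless g = 1, where the eigenvalue r(h)(1) is 1. *)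
Lemma twist_counit r : (counit \o twist r = (counit : 'Hom(D, K^o)))%VF.
Proof.
apply/lfunP; apply: double_lin_ext; try by move=> a x y; rewrite linearP.
move=> p; rewrite comp_lfunE twist_basis linearZ /= !double_counitE.
by case: eqP => [->|_]; rewrite ?scaler0 // pairing1r scale1r.
Qed.

Lemma twist_antipode r :
  (twist r \o antipode = (antipode : 'End(D)) \o twist r)%VF.
Proof.
apply/lfunP; apply: double_lin_ext; try by move=> a x y; rewrite linearP.
move=> p; rewrite !comp_lfunE twist_basis linearZ /= !double_antipodeE.
(* The antipode sends e_g # h to a basis vector indexed by h^-1 g^-1 h; this is conjugation by h^-1,
   up to rewriting the double inverse. *)
have := pairingJ r p.2^-1%g p.1^-1%g p.2^-1%g; rewrite invgK twist_basis /= => ->.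
by rewrite pairingVl pairingVr invrK.
Qed.

Lemma twist_hopf_aut r : is_hopf_aut (twist r).
Proof.
apply/hopf_autP; split.
- exact: twist_ker.
- by split; [apply: twist1 | move=> x y; apply: twistM].
- exact: twist_comul.
- exact: twist_counit.
- exact: twist_antipode.
Qed.

Lemma twist_mul r s : twist (r * s)%g = (twist r \o twist s)%VF.
Proof.
apply/lfunP; apply: double_lin_ext; try by move=> a x y; rewrite linearP.
move=> p; rewrite comp_lfunE !twist_basis linearZ /= twist_basis scalerA.
(* The composite applies s first, so its eigenvalues come out in the opposite order. *)
by rewrite pairing_ghomM mulrC.
Qed.

(** The value r(h)(g) is recovered as the (g, h) coordinate of the image of e_g # h. *)
Lemma twist_inj : injective (@twist K gT).
Proof.
move=> r s rs; apply: pairing_inj => h g.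
have /ffunP/(_ (g, h)) := congr1 (fun f : 'End(D) => f (dbasis K (g, h))) rs.
by rewrite !twist_basis ffunE [RHS]ffunE dbasisE eqxx => /(mulIf (oner_neq0 _)).
Qed.

Definition twist_aut r := HopfAut (twist_hopf_aut r).

Lemma twist_autM : {morph twist_aut : r s / (r * s)%g}.
Proof. by move=> r s; apply/val_inj/twist_mul. Qed.

HB.instance Definition _ := isMultiplicative.Build _ _ twist_aut twist_autM.

End Twist.

Theorem proposition4p4 (k : closedFieldType) (chark : [pchar k] =i pred0)
    (gT : finGroupType) :
  (forall r : ghom gT (dualgroup k gT), is_hopf_aut (twist r)) /\
  exists Phi : {multiplicative ghom gT (dualgroup k gT) -> hopf_aut (drinfeld_double k gT)},
    injective Phi /\
    forall r : ghom gT (dualgroup k gT), hopf_aut_fun (Phi r) = twist r.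
Proof.
split; first exact: twist_hopf_aut.
(* The underlying endomorphism of [twist_aut r] is [twist r] by definition, so injectivity descends
   from [twist_inj]. *)
exists (@twist_aut k gT); split=> // r s /(congr1 (@hopf_aut_fun _ _)).
exact: twist_inj.
Qed.
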